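(* Let $\mathcal{P}$ be a collection of probability distributions on $\mathcal{Z}^{n+1}$ and let $\alpha>0$. A prediction set $C_\alpha^{Z^n}$ for $Z_{n+1}$, i.e. a family $(C_\alpha^{z^n})_{z^n\in\mathcal{Z}^n}$ of subsets of $\mathcal{Z}$, is equivalent to the test $C_\alpha:\mathcal{Z}^{n+1}\to\{0,1\}$ given by $$C_\alpha(z^{n+1}) := \mathbb{I}\{z_{n+1}\notin C_\alpha^{z^n}\},\qquad z^{n+1}=(z^n,z_{n+1}),$$ in the sense that this is a one-to-one correspondence between prediction sets and tests, the prediction set being recovered from the test by $C_\alpha^{z^n}=\{z\in\mathcal{Z}: C_\alpha(z^n,z)=0\}$. Moreover, the prediction set $C_\alpha^{Z^n}$ is valid at level $\alpha$ for the model $\mathcal{P}$ if and only if the test $C_\alpha$ is valid at level $\alpha$ for the hypothesis $\mathcal{P}$.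
   Context: $\mathcal{Z}$ is a (measurable) sample space and $Z^{n+1}=(Z_1,\dots,Z_{n+1})=(Z^n,Z_{n+1})$ denotes a random element of $\mathcal{Z}^{n+1}$. Prediction sets are assumed jointly measurable, i.e. $\{z^{n+1}: z_{n+1}\in C_\alpha^{z^n}\}$ is measurable in $\mathcal{Z}^{n+1}$; tests are measurable maps $\mathcal{Z}^{n+1}\to\{0,1\}$, where $1$ means rejection. The prediction set $C_\alpha^{Z^n}$ is valid at level $\alpha$ for the model $\mathcal{P}$ if $P(Z_{n+1}\in C_\alpha^{Z^n})\ge 1-\alpha$ for every $P\in\mathcal{P}$ (the probability is over the whole tuple $Z^{n+1}\sim P$). The test $C_\alpha$ is valid at level $\alpha$ for the hypothesis $\mathcal{P}$ if $\mathrm{E}^P[C_\alpha(Z^{n+1})]\le\alpha$ for every $P\in\mathcal{P}$. *)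

(* Defs.v *)
From HB Require Import structures.
From mathcomp Require Import all_boot all_order all_algebra.
From mathcomp Require Import all_classical all_reals all_analysis.

Set Implicit Arguments.
Unset Strict Implicit.
Unset Printing Implicit Defensive.

Import Order.TTheory GRing.Theory Num.Theory.

Local Open Scope classical_set_scope.
Local Open Scope ring_scope.

(* The sample space of z^{n+1} is n.+1.-tuple Z with the product sigma-algebra;
   z^{n+1} = (z^n, z_{n+1}) is split into [past z] = z^n and
   [newest z] = z_{n+1}, and reassembled by [tuple of rcons zn z']. *)
Definition past (T : Type) (n : nat) (z : n.+1.-tuple T) : n.-tuple T :=
  [tuple tnth z (widen_ord (leqnSn n) i) | i < n].

Definition newest (T : Type) (n : nat) (z : n.+1.-tuple T) : T :=
  tnth z ord_max.

Record prediction_set (d : measure_display) (Z : measurableType d) (n : nat) :=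
  PredictionSet {
    pset :> n.-tuple Z -> set Z;
    measurable_pset :
      measurable [set z : n.+1.-tuple Z | pset (past z) (newest z)]
  }.

(* The codomain {0, 1} is bool, carrying the discrete sigma-algebra and
   coerced to numbers by nat_of_bool; 1 (true) means rejection. *)
Notation test Z n := {mfun (n.+1).-tuple Z >-> bool}.

Section test_of_prediction_set.
Context (d : measure_display) (Z : measurableType d) (n : nat).
Variable C : prediction_set Z n.

Definition miscoverage (z : n.+1.-tuple Z) : bool :=
  newest z \notin C (past z).

Lemma measurable_miscoverage : measurable_fun [set: n.+1.-tuple Z] miscoverage.
Proof.
apply: (measurable_fun_bool false); rewrite setTI.
rewrite (_ : _ @^-1` _ = [set z | C (past z) (newest z)]).
  exact: measurable_pset.
apply/seteqP; split=> z /=; rewrite /miscoverage.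
  by move/negbFE; rewrite inE.
by move=> Cz; apply/negbTE; rewrite negbK inE.
Qed.

HB.instance Definition _ :=
  isMeasurableFun.Build _ _ _ _ miscoverage measurable_miscoverage.

Definition test_of : test Z n := [mfun of miscoverage].

End test_of_prediction_set.

Section validity.
Context (R : realType) (d : measure_display) (Z : measurableType d) (n : nat).
Local Open Scope ereal_scope.

(* Z^{n+1} is the identity on the sample space: P is its law. *)
Definition prediction_set_valid (PP : set (probability (n.+1.-tuple Z) R))
    (alpha : R) (C : prediction_set Z n) : Prop :=
  forall P, PP P ->
    (1 - alpha)%:E <= P [set z | newest z \in C (past z)].

Definition test_valid (PP : set (probability (n.+1.-tuple Z) R))
    (alpha : R) (phi : test Z n) : Prop :=
  forall P, PP P -> 'E_P[fun z => (phi z)%:R] <= alpha%:E.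

End validity.

(* Main.v *)
Require Import Defs.
From mathcomp Require Import all_boot all_order all_algebra.
From mathcomp Require Import all_classical all_reals all_analysis.

Local Open Scope classical_set_scope.
Local Open Scope ring_scope.

Import Order.TTheory GRing.Theory Num.Theory.

(** Appending a last entry is inverse to splitting a tuple into [past] and [newest], so a family of
    subsets of [Z] indexed by [n]-tuples is the same thing as a subset of the space of
    [n.+1]-tuples. A test is the indicator of the complement of such a subset, and joint
    measurability of the family is exactly measurability of the test; hence the bijection
    ([test_ofK], [prediction_set_ofK]). For validity, the expectation of a 0/1 variable is the
    probability of rejection ([expectation_test]), and rejection is the complement of coverage, so
    coverage has probability one minus that expectation, for each [P] separately. *)

Lemma past_rcons (T : Type) (n : nat) (zn : n.-tuple T) (z : T) :
  past [tuple of rcons zn z] = zn.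
Proof.
apply: eq_from_tnth => i.
by rewrite tnth_mktuple !(tnth_nth z) /= nth_rcons size_tuple ltn_ord.
Qed.

Lemma newest_rcons (T : Type) (n : nat) (zn : n.-tuple T) (z : T) :
  newest [tuple of rcons zn z] = z.
Proof.
by rewrite /newest (tnth_nth z) /= nth_rcons size_tuple ltnn eqxx.
Qed.

Lemma rcons_past_newest (T : Type) (n : nat) (z : n.+1.-tuple T) :
  [tuple of rcons (past z) (newest z)] = z.
Proof.
apply: eq_from_tnth => i; rewrite (tnth_nth (newest z)) /= nth_rcons (size_tuple (past z)).
case: ltnP => [ltin|lein].
  rewrite -(tnth_nth _ (past z) (Ordinal ltin)) tnth_mktuple.
  by congr (tnth z _); apply: val_inj.
have eqin : i = n :> nat by apply/eqP; rewrite eqn_leq lein -ltnS ltn_ord.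
by rewrite eqin eqxx; congr (tnth z _); apply: val_inj.
Qed.

(** The other field is a proof of measurability, settled by proof irrelevance. *)
Lemma prediction_set_eqP (d : measure_display) (Z : measurableType d) (n : nat)
    (C D : prediction_set Z n) : (C : n.-tuple Z -> set Z) = D -> C = D.
Proof.
case: C D => [c mc] [e me] /= ce; case: _ / ce me => me.
by rewrite (Prop_irrelevance mc me).
Qed.

Section prediction_set_of_test.
Context {d : measure_display} {Z : measurableType d} {n : nat}.
Variable phi : test Z n.

Definition acceptance (zn : n.-tuple Z) : set Z :=
  [set z | ~~ phi [tuple of rcons zn z]].

(** Once each tuple is glued back from its two parts, this set is the preimage of [false] under
    [phi]. *)
Lemma measurable_acceptance :
  measurable [set z : n.+1.-tuple Z | acceptance (past z) (newest z)].
Proof.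
rewrite [X in measurable X](_ : _ = phi @^-1` [set false]).
  exact: measurable_funPTI.
apply/seteqP; split=> z /=; rewrite /acceptance /=.
  by rewrite rcons_past_newest => /negbTE.
by rewrite rcons_past_newest => ->.
Qed.

Definition prediction_set_of : prediction_set Z n :=
  PredictionSet measurable_acceptance.

End prediction_set_of_test.

Lemma acceptance_test_of (d : measure_display) (Z : measurableType d) (n : nat)
    (C : prediction_set Z n) : acceptance (test_of C) = C.
Proof.
apply/funext => zn; apply/seteqP.
by split=> z; rewrite /acceptance /= /miscoverage newest_rcons past_rcons negbK inE.
Qed.

Lemma test_ofK (d : measure_display) (Z : measurableType d) (n : nat) :
  cancel (@test_of d Z n) prediction_set_of.
Proof. by move=> C; apply: prediction_set_eqP; exact: acceptance_test_of. Qed.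

Lemma prediction_set_ofK (d : measure_display) (Z : measurableType d) (n : nat) :
  cancel prediction_set_of (@test_of d Z n).
Proof.
move=> phi; apply/mfuneqP => z /=; rewrite /miscoverage.
(* Membership in [acceptance] is by definition the truth value of a boolean, so [asboolb] reduces it
   to that boolean. *)
by apply: negb_inj; rewrite negbK [LHS]asboolb rcons_past_newest.
Qed.

Lemma expectation_test (R : realType) (d : measure_display)
    (Z : measurableType d) (n : nat) (P : probability (n.+1.-tuple Z) R)
    (phi : test Z n) :
  ('E_P[fun z => (phi z)%:R] = P (phi @^-1` [set true]))%E.
Proof.
have mphi : measurable (phi @^-1` [set true]) by exact: measurable_funPTI.
rewrite -(expectation_indic P mphi); congr ('E_P[_])%E.
apply/funext => z; rewrite indicE.
suff -> : (z \in phi @^-1` [set true]) = phi z by [].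
by apply/idP/idP; rewrite inE.
Qed.

Lemma prediction_set_valid_test_of (R : realType) (d : measure_display)
    (Z : measurableType d) (n : nat) (PP : set (probability (n.+1.-tuple Z) R))
    (alpha : R) (C : prediction_set Z n) :
  prediction_set_valid PP alpha C <-> test_valid PP alpha (test_of C).
Proof.
(* The two comparisons agree as booleans for every single [P], whether or not it lies in [PP]. *)
suff E (P : probability (n.+1.-tuple Z) R) :
    ((1 - alpha)%:E <= P [set z | newest z \in C (past z)])%E =
    ('E_P[fun z => (test_of C z)%:R] <= alpha%:E)%E.
  by split=> H P /H; rewrite E.
rewrite expectation_test.
set A := _ @^-1` _.
have mA : measurable A by exact: measurable_funPTI.
have -> : [set z | newest z \in C (past z)] = ~` A.
  apply/seteqP; split=> z /=; rewrite /A /= /miscoverage.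
    by move=> ->.
  by move/negP; rewrite negbK.
(* [P A] is finite, so the claim descends to real numbers: [1 - alpha <= 1 - p] iff [p <= alpha]. *)
rewrite probability_setC // -(fineK (fin_num_measure P A mA)).
by rewrite -EFinB !lee_fin lerD2l lerN2.
Qed.

Theorem theorem1 (R : realType) (d : measure_display) (Z : measurableType d)
    (n : nat) (PP : set (probability (n.+1.-tuple Z) R)) (alpha : R) :
  0 < alpha ->
  [/\ bijective (fun C : prediction_set Z n => test_of C),
      forall (C : prediction_set Z n) (zn : n.-tuple Z),
        C zn = [set z : Z | test_of C [tuple of rcons zn z] = 0%N :> nat] &
      forall C : prediction_set Z n,
        prediction_set_valid PP alpha C <-> test_valid PP alpha (test_of C)].
Proof.
move=> _; split.
- by exists prediction_set_of; [exact: test_ofK | exact: prediction_set_ofK].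
- move=> C zn; rewrite -[in LHS]acceptance_test_of.
  by apply/seteqP; split=> z; rewrite /acceptance /=; case: miscoverage.
- by move=> C; exact: prediction_set_valid_test_of.
Qed.
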